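(* There exists a family $\{B^{m,n}\}_{m,n\ge 1}$ of regular CW complexes, indexed by pairs of integers $m,n\ge 1$ (called bisimplices), such that for all $m,n \ge 1$: (1) $B^{m,n}$ has a unique maximal cell, and so $B^{m,n}$ is homeomorphic to a ball; (2) $B^{m,n}$ has dimension $m+n$; (3) the $1$-skeleton of $B^{m,n}$ is the complete bipartite graph $K_{m+1,n+1}$.
   Context: A CW complex is regular if the characteristic maps of its (closed) cells are embeddings. Cells are ordered by inclusion of closed cells; a maximal cell is one that is maximal for this order. $K_{p,q}$ denotes the complete bipartite graph with parts of sizes $p$ and $q$. *)

(* Defs.v *)
From HB Require Import structures.
From mathcomp Require Import all_boot all_order all_algebra.
From mathcomp Require Import all_classical all_reals all_analysis.
Import Order.TTheory GRing.Theory Num.Theory.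
Import numFieldNormedType.Exports.

Set Implicit Arguments.
Unset Strict Implicit.
Unset Printing Implicit Defensive.

Local Open Scope classical_set_scope.
Local Open Scope ring_scope.

(* 'rV[R]_n carries the product topology, but its library norm is the sup norm;
   the balls below are Euclidean. *)
Definition sqnorm (R : realType) (n : nat) (x : 'rV[R]_n) : R :=
  \sum_(i < n) x 0 i ^+ 2.

Definition closed_disk (R : realType) (n : nat) : set 'rV[R]_n :=
  [set x | sqnorm x <= 1].

Definition open_disk (R : realType) (n : nat) : set 'rV[R]_n :=
  [set x | sqnorm x < 1].

(* For n = 0 this is empty and both disks are a point. *)
Definition disk_boundary (R : realType) (n : nat) : set 'rV[R]_n :=
  [set x | sqnorm x = 1].

(* [f] restricts to a homeomorphism from [A] onto [f @` A], both with the
   subspace topology; the values of [f] outside [A] are irrelevant. *)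
Definition embedding_on (T : ptopologicalType) (U : topologicalType)
    (A : set T) (f : T -> U) : Prop :=
  {within A, continuous f} /\
  exists g : U -> T,
    (forall x, A x -> g (f x) = x) /\ {within f @` A, continuous g}.

(* A Hausdorff space with a CW structure given by characteristic maps, of which
   only the values on the closed disk matter. *)
Record cw_complex (R : realType) := CWComplex {
  space : topologicalType;
  cell : Type;
  cdim : cell -> nat;
  char_map : forall c : cell, 'rV[R]_(cdim c) -> space;
  cw_hausdorff : hausdorff_space space;
  cw_continuous : forall c,
    {within @closed_disk R (cdim c), continuous (@char_map c)};
  cw_open_embedding : forall c,
    embedding_on (@open_disk R (cdim c)) (@char_map c);
  cw_disjoint : forall c c',
    (@char_map c @` @open_disk R (cdim c)) `&`
    (@char_map c' @` @open_disk R (cdim c')) !=set0 -> c = c';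
  cw_cover : forall x : space,
    exists c, (@char_map c @` @open_disk R (cdim c)) x;
  cw_closure_finite : forall c, exists F : set cell,
    [/\ finite_set F,
        forall c', F c' -> (cdim c' < cdim c)%N &
        @char_map c @` @disk_boundary R (cdim c) `<=`
          \bigcup_(c' in F) (@char_map c' @` @open_disk R (cdim c'))];
  cw_weak_topology : forall A : set space,
    (forall c, closed (A `&` (@char_map c @` @closed_disk R (cdim c)))) ->
    closed A
}.

Definition closed_cell (R : realType) (X : cw_complex R) (c : cell X) :
    set (space X) :=
  @char_map R X c @` @closed_disk R (cdim c).

Definition regular (R : realType) (X : cw_complex R) : Prop :=
  forall c : cell X,
    embedding_on (@closed_disk R (cdim c)) (@char_map R X c).

Definition cell_le (R : realType) (X : cw_complex R) (c c' : cell X) : Prop :=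
  closed_cell c `<=` closed_cell c'.

Definition maximal_cell (R : realType) (X : cw_complex R) (c : cell X) : Prop :=
  forall c' : cell X, cell_le c c' -> c' = c.

Definition has_dimension (R : realType) (X : cw_complex R) (d : nat) : Prop :=
  (exists c : cell X, cdim c = d) /\ (forall c : cell X, (cdim c <= d)%N).

Definition homeomorphic_to_ball (R : realType) (X : cw_complex R) (d : nat) :
    Prop :=
  exists f : 'rV[R]_d -> space X,
    embedding_on (@closed_disk R d) f /\ f @` @closed_disk R d = setT.

(* Edges form a type of their own, so that an isomorphism between the
   1-skeleton of a complex and a simple graph excludes loops and multiple
   edges in the former. *)
Record graph := Graph {
  vertex : Type;
  edge : Type;
  incident : edge -> vertex -> Prop
}.

Definition graph_iso (G H : graph) : Prop :=
  exists (f : vertex G -> vertex H) (g : edge G -> edge H),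
    [/\ bijective f, bijective g &
        forall e v, incident e v <-> incident (g e) (f v)].

Definition complete_bipartite (p q : nat) : graph :=
  @Graph ('I_p + 'I_q)%type ('I_p * 'I_q)%type
    (fun e v => v = inl e.1 \/ v = inr e.2).

Definition one_skeleton (R : realType) (X : cw_complex R) : graph :=
  @Graph {c : cell X | cdim c == 0%N} {c : cell X | cdim c == 1%N}
    (fun e v => cell_le (sval v) (sval e)).

(* Main.v *)
(* Let V be the disjoint union of two colour classes with m + 1 and n + 1
   elements. For a point w of the simplex spanned by V, the excess of w on a
   colour class is the sum of the barycentric coordinates of w on that class
   minus their maximum; it vanishes iff w has at most one nonzero coordinate of
   that colour. The complex is
     X = {w in the simplex | the excesses of w on both colours are equal},
   and its open cells are the sets of points of X with a given support. A
   support has at most one element of each colour (a vertex, or an edge between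
   the two colours), or at least two elements of each colour.
   For a support S of the last kind, with p and q elements of the two colours,
   consider the cone over the closed cell. Adding a constant t to the
   coordinates of a colour class with p elements adds (p - 1) t to its excess,
   so the equation of the cone is invariant under the translations along
   (1 / (p - 1), ..., 1 / (q - 1), ...). Modulo these translations the solutions
   form a space of dimension p + q - 2, and nonnegativity only bounds the
   translation parameter from below: the cone is the epigraph of a homogeneous
   function on R^(p + q - 2). Replacing that function by the Euclidean norm turns
   the projectivized cone into a disk. *)

From HB Require Import structures.
Require Import Defs.
From mathcomp Require Import all_boot all_order all_algebra.
From mathcomp Require Import all_classical all_reals all_analysis.
From mathcomp Require Import zify ring lra.
Import Order.TTheory GRing.Theory Num.Theory.
Import numFieldNormedType.Exports.

Set Implicit Arguments.
Unset Strict Implicit.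
Unset Printing Implicit Defensive.

Local Open Scope classical_set_scope.
Local Open Scope ring_scope.

(** * Continuity, embeddings and graphs *)

Lemma cvg_row (R : realType) (T : topologicalType) (k : nat)
    (f : T -> 'rV[R]_k) (x : T) :
  (forall i, (fun y => f y 0 i) @ x --> f x 0 i) -> f @ x --> f x.
Proof.
move=> fx A [P /= AP sPA]; rewrite /nbhs/=.
have : \forall y \near x, forall i, P 0 i (f y 0 i).
  by apply: filter_forall => i; apply: fx; exact: AP.
by apply: filterS => y Py; apply: sPA => i j; rewrite ord1.
Qed.

Lemma cvg_sumr (R : realType) (T : topologicalType) (I : Type) (r : seq I)
    (P : pred I) (f : I -> T -> R) (x : T) :
  (forall i, f i @ x --> f i x) ->
  (fun y => \sum_(i <- r | P i) f i y) @ x --> \sum_(i <- r | P i) f i x.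
Proof. by move=> cf; apply: cvg_big => //; exact: add_continuous. Qed.

Lemma cvg_bigmax (R : realType) (T : topologicalType) (I : Type) (r : seq I)
    (P : pred I) (f : I -> T -> R) (f0 : T -> R) (x : T) :
  f0 @ x --> f0 x -> (forall i, f i @ x --> f i x) ->
  (fun y => \big[Num.max/f0 y]_(i <- r | P i) f i y) @ x -->
    \big[Num.max/f0 x]_(i <- r | P i) f i x.
Proof.
move=> cf0 cf; elim: r => [|i r IHr].
  by under eq_fun do rewrite big_nil; rewrite big_nil.
under eq_fun do rewrite big_cons; rewrite big_cons.
case: (P i); last exact: IHr.
exact: (@continuous_max R T (f i)
  (fun y => \big[Num.max/f0 y]_(i <- r | P i) f i y) x (cf i) IHr).
Qed.

(** The starting value is itself a function because the minimum in [height] starts from one of its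
    own terms, which varies with the point. *)
Lemma cvg_bigmin (R : realType) (T : topologicalType) (I : Type) (r : seq I)
    (P : pred I) (f : I -> T -> R) (f0 : T -> R) (x : T) :
  f0 @ x --> f0 x -> (forall i, f i @ x --> f i x) ->
  (fun y => \big[Num.min/f0 y]_(i <- r | P i) f i y) @ x -->
    \big[Num.min/f0 x]_(i <- r | P i) f i x.
Proof.
move=> cf0 cf; elim: r => [|i r IHr].
  by under eq_fun do rewrite big_nil; rewrite big_nil.
under eq_fun do rewrite big_cons; rewrite big_cons.
case: (P i); last exact: IHr.
exact: (@continuous_min R T (f i)
  (fun y => \big[Num.min/f0 y]_(i <- r | P i) f i y) x (cf i) IHr).
Qed.

Lemma inj_surj_bijective (A B : Type) (f : A -> B) :
  injective f -> (forall b, exists a, f a = b) -> bijective f.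
Proof.
move=> finj /choice[g fg]; exists g => // a.
by apply: finj; rewrite fg.
Qed.

Lemma graph_iso_sym (G H : graph) : graph_iso G H -> graph_iso H G.
Proof.
move=> [f [g [[f' fK f'K] [g' gK g'K] inc]]]; exists f', g'; split.
- by exists f.
- by exists g.
- by move=> e v; rewrite inc g'K f'K.
Qed.

Lemma embedding_onS (T : ptopologicalType) (U : topologicalType) (A B : set T)
    (f : T -> U) :
  A `<=` B -> embedding_on B f -> embedding_on A f.
Proof.
move=> AB [cf [g [gf cg]]]; split; first exact: continuous_subspaceW cf.
exists g; split=> [x /AB|]; first exact: gf.
by apply: continuous_subspaceW cg; exact: image_subset.
Qed.

(** * The combinatorics of supports *)

Section Bisimplex.
Variables (R : realType) (k : nat) (col : 'I_k -> bool).
Implicit Types (w : 'rV[R]_k) (S : {set 'I_k}) (c : bool).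

(** The default value 0 does not affect the maximum of nonnegative coordinates over a nonempty
    class, and it gives an empty class excess 0. *)
Definition excess w c : R :=
  \sum_(i | col i == c) w 0 i - \big[Num.max/0]_(i | col i == c) w 0 i.

Definition cone w := (forall i, 0 <= w 0 i) /\ excess w false = excess w true.

Definition bisimplex : set 'rV[R]_k := [set w | cone w /\ \sum_i w 0 i = 1].

Definition supp w : {set 'I_k} := [set i | w 0 i != 0].

Definition colour_class S c : {set 'I_k} := [set i in S | col i == c].

Definition is_face S : bool :=
  let p := #|colour_class S false| in let q := #|colour_class S true| in
  [|| (p + q == 1)%N, (p == 1)%N && (q == 1)%N | (1 < p)%N && (1 < q)%N].

(** On a vertex or an edge both excesses vanish identically, so only the normalization of the sum
    costs a dimension; on a larger face the equality of the excesses costs a second one. *)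
Definition face_dim S : nat := if (#|S| <= 2)%N then #|S|.-1 else #|S|.-2.

Lemma supp_sub w S : (forall i, i \notin S -> w 0 i = 0) <-> supp w \subset S.
Proof.
split=> [w0|/fintype.subsetP sS i iS].
  apply/fintype.subsetP => i; rewrite inE;
    apply: contraNT => /w0 ->; exact: eqxx.
by apply/eqP/negPn; apply: contra iS => wi; apply: sS; rewrite inE.
Qed.

Lemma card_colour_class S :
  #|S| = (#|colour_class S false| + #|colour_class S true|)%N.
Proof.
rewrite -(cardsID [set i | col i == false] S); congr (_ + _)%N;
  apply: eq_card => i; rewrite !inE; first by [].
by case: (col i); rewrite ?andbF ?andbT.
Qed.

Lemma excess_argmax w c i :
  (forall j, 0 <= w 0 j) -> col i = c ->
  (forall j, col j = c -> w 0 j <= w 0 i) ->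
  excess w c = \sum_(j | col j == c) w 0 j - w 0 i.
Proof.
move=> w0 ic wi; congr (_ - _); apply/eqP; rewrite eq_le; apply/andP; split.
  by apply: bigmax_le => // j /eqP; exact: wi.
by apply: (@le_bigmax_cond _ _ _ _ i (fun j => col j == c)); apply/eqP.
Qed.

Lemma ex_argmax w S c : (forall j, 0 <= w 0 j) -> supp w \subset S ->
  (0 < #|colour_class S c|)%N ->
  exists2 i, i \in colour_class S c & forall j, col j = c -> w 0 j <= w 0 i.
Proof.
move=> w0 /supp_sub wS /card_gt0P[i0 i0S].
pose P i := i \in colour_class S c.
case: (@Order.TotalTheory.arg_maxP _ _ _ i0 P (fun i => w 0 i) i0S).
move=> i iS imax.
exists i => // j jc; have [jS|/wS ->//] := boolP (j \in S).
by apply: imax; rewrite /P !inE jS jc eqxx.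
Qed.

(** The translation keeps the same maximizer, so the maximum grows by [t] while the sum grows by [t]
    for each element of the class. *)
Lemma excess_shift (u v : 'rV[R]_k) S c (t : R) :
  (forall j, 0 <= u 0 j) -> (forall j, 0 <= v 0 j) ->
  supp u \subset S -> supp v \subset S -> (0 < #|colour_class S c|)%N ->
  (forall i, i \in colour_class S c -> u 0 i = v 0 i + t) ->
  excess u c = excess v c + (#|colour_class S c|%:R - 1) * t.
Proof.
move=> u0 v0 uS vS Sc uv.
have [i iS imax] := ex_argmax v0 vS Sc.
have ic : col i = c by move: iS; rewrite inE => /andP[_ /eqP].
rewrite (excess_argmax v0 ic imax) (excess_argmax (i := i) u0 ic); last first.
  move=> j jc; have [jS|jS] := boolP (j \in S).
    by rewrite !uv ?lerD2r ?imax// inE jS jc eqxx.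
  by rewrite (proj2 (supp_sub u S) uS).
have sumE w : supp w \subset S ->
    \sum_(j | col j == c) w 0 j = \sum_(j in colour_class S c) w 0 j.
  move=> /supp_sub wS.
  rewrite (bigID (mem S))/= [X in _ + X]big1 ?addr0; last first.
    by move=> j /andP[_ /wS].
  by apply: eq_bigl => j; rewrite !inE andbC.
rewrite !sumE// (eq_bigr (fun j => v 0 j + t)) => [|j]; last exact: uv.
rewrite big_split/= sumr_const uv// -mulr_natl; ring.
Qed.

Lemma excessZ w c (l : R) : 0 <= l -> excess (l *: w) c = l * excess w c.
Proof.
move=> l0; rewrite /excess mulrBr; congr (_ - _).
  by rewrite mulr_sumr; apply: eq_bigr => i _; rewrite mxE.
rewrite (big_morph ( *%R l) (fun x y => maxr_pMr x y l0) (mulr0 l)).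
by apply: eq_bigr => i _; rewrite mxE.
Qed.

Lemma cone_scale w (l : R) : 0 <= l -> cone w -> cone (l *: w).
Proof.
move=> l0 [w0 ew]; split=> [i|]; first by rewrite mxE mulr_ge0.
by rewrite !excessZ// ew.
Qed.

(** Once a largest coordinate of the class is cancelled, the excess is the sum of the other ones,
    all nonnegative; it vanishes only if each of them does. *)
Lemma excess_eq0 w c : (forall j, 0 <= w 0 j) ->
  (excess w c == 0) = (#|colour_class (supp w) c| <= 1)%N.
Proof.
move=> w0; have [c0|c0] := posnP #|colour_class (supp w) c|.
  rewrite c0 leq0n /excess.
  have wc i : col i == c -> w 0 i = 0.
    move=> ic; apply/eqP/negPn/negP => wi.
    move: c0 => /eqP; rewrite cards_eq0 => /set0Pn; apply.
    by exists i; rewrite !inE wi.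
  rewrite big1// sub0r oppr_eq0.
  rewrite eq_le bigmax_ge_id andbT.
  by apply: bigmax_le => // i /wc ->.
have [i iS imax] := ex_argmax w0 (subxx _) c0.
have /andP[wi ic] : (w 0 i != 0) && (col i == c) by move: iS; rewrite !inE.
rewrite (excess_argmax w0 (eqP ic) imax) (bigD1 i)//= addrAC subrr add0r.
rewrite psumr_eq0//; apply/allP/card_le1P => [h j jS l|h j _].
  apply/idP/eqP => [lS|->//].
  suff {j l jS lS} h' j : j \in colour_class (supp w) c -> j = i.
    by rewrite (h' _ jS) (h' _ lS).
  rewrite !inE => /andP[wj jc]; apply: contraNeq wj => ji.
  by have := h j (mem_index_enum _); rewrite jc ji.
apply/implyP => /andP[jc ji]; apply: contraNT ji => wj.
by have := h i iS j; rewrite !inE wj jc => /esym/=.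
Qed.

(** The excesses are equal, so they vanish together: either both colours have at most one element in
    the support, or both have at least two. The total 1 excludes the empty support. *)
Lemma supp_face w : bisimplex w -> is_face (supp w).
Proof.
move=> [[w0 ew] w1]; rewrite /is_face.
have := excess_eq0 false w0; have := excess_eq0 true w0; rewrite ew => ->.
have : (0 < #|supp w|)%N.
  rewrite card_gt0; apply: contra_eq_neq w1 => s0.
  rewrite big1 => [|i _]; first by rewrite eq_sym oner_eq0.
  by move/setP/(_ i): s0; rewrite !inE => /negbT; rewrite negbK => /eqP.
rewrite (card_colour_class (supp w)).
by move: #|_| #|_| => [|[|p]] [|[|q]].
Qed.

(** The change of formula in [face_dim] does no harm: no face has exactly three elements, so the
    jump from at most 2 to at least 4 elements raises the dimension from at most 1 to at least 2. *)
Lemma face_dim_lt S S' : is_face S -> is_face S' -> S \proper S' ->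
  (face_dim S < face_dim S')%N.
Proof.
move=> fS fS' /proper_card; move: fS fS'.
rewrite /is_face /face_dim !(@card_colour_class S) !(@card_colour_class S').
by do 2 case: ifP; lia.
Qed.
End Bisimplex.

Section FaceShapes.
Variables (k : nat) (col : 'I_k -> bool).
Implicit Types S : {set 'I_k}.

Lemma is_face1 i : is_face col [set i].
Proof. by rewrite /is_face -card_colour_class cards1. Qed.

Lemma is_face2 i j : col i = false -> col j = true -> is_face col [set i; j].
Proof.
move=> ic jc; rewrite /is_face.
rewrite (_ : colour_class _ _ false = [set i]%SET); last first.
  apply/setP => l; rewrite !inE; case: (eqVneq l i) => [->|_].
    by rewrite ic.
  by case: eqP => [->|]; rewrite ?jc.
rewrite (_ : colour_class _ _ true = [set j]%SET) ?cards1//.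
apply/setP => l; rewrite !inE; case: (eqVneq l j) => [->|_].
  by rewrite jc orbT.
by case: eqP => [->|]; rewrite ?ic.
Qed.

Lemma face_card2 S : is_face col S -> #|S| = 2 ->
  exists i j, [/\ S = [set i; j]%SET, col i = false & col j = true].
Proof.
move=> fS S2; have /andP[/cards1P[i Si] /cards1P[j Sj]] :
    (#|colour_class col S false| == 1)%N && (#|colour_class col S true| == 1)%N.
  by move: fS S2; rewrite /is_face (card_colour_class col S); lia.
exists i, j; split.
- apply/setP => l; rewrite !inE.
  have := finset.in_set1 l i; have := finset.in_set1 l j.
  by rewrite -Si -Sj !inE => <- <-; case: (col l); rewrite ?andbF ?andbT ?orbF.
- by have := finset.set11 i; rewrite -Si inE => /andP[_ /eqP].
- by have := finset.set11 j; rewrite -Sj inE => /andP[_ /eqP].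
Qed.

Lemma face_dim_eq0 S : is_face col S -> face_dim S = 0 -> #|S| = 1.
Proof.
by rewrite /is_face /face_dim !(card_colour_class col S); case: ifP; lia.
Qed.

Lemma face_dim_eq1 S : is_face col S -> face_dim S = 1 -> #|S| = 2.
Proof.
by rewrite /is_face /face_dim !(card_colour_class col S); case: ifP; lia.
Qed.

End FaceShapes.

(** * Charts of the closed cells *)

Section Charts.
Variables (R : realType) (k : nat) (col : 'I_k -> bool).
Implicit Types (w : 'rV[R]_k) (S : {set 'I_k}) (c : bool).

Lemma sqnorm_ge0 N (x : 'rV[R]_N) : 0 <= sqnorm x.
Proof. by apply: sumr_ge0 => i _; exact: sqr_ge0. Qed.

Lemma cvg_sqnorm N (T : topologicalType) (f : T -> 'rV[R]_N) (x : T) :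
  (forall i, (fun y => f y 0 i) @ x --> f x 0 i) ->
  (fun y => sqnorm (f y)) @ x --> sqnorm (f x).
Proof.
move=> cf; apply: (@cvg_sumr _ _ _ _ _ (fun i y => f y 0 i ^+ 2)) => i.
by rewrite expr2; under eq_fun do rewrite expr2; apply: cvgM.
Qed.

Definition enorm N (x : 'rV[R]_N) : R := Num.sqrt (sqnorm x).

Lemma enormZ N (x : 'rV[R]_N) (l : R) : 0 <= l -> enorm (l *: x) = l * enorm x.
Proof.
move=> l0; rewrite /enorm -{2}(ger0_norm l0) -sqrtr_sqr -sqrtrM ?sqr_ge0//.
congr (Num.sqrt _); rewrite /sqnorm mulr_sumr.
by apply: eq_bigr => i _; rewrite mxE exprMn.
Qed.

Lemma enorm0 N : enorm (0 : 'rV[R]_N) = 0.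
Proof. by rewrite -(scale0r 0) enormZ// mul0r. Qed.

Lemma enorm_eq0 N (x : 'rV[R]_N) : enorm x = 0 -> x = 0.
Proof.
move=> /eqP; rewrite sqrtr_eq0 => x0.
have : sqnorm x == 0 by rewrite eq_le x0 sqnorm_ge0.
rewrite psumr_eq0 => [/allP h|i _]; last exact: sqr_ge0.
apply/rowP => i; rewrite mxE; apply/eqP.
by have := h i (mem_index_enum _); rewrite /= sqrf_eq0.
Qed.

Lemma enorm_le1 N (x : 'rV[R]_N) : (enorm x <= 1) = (sqnorm x <= 1).
Proof. by rewrite -{1}sqrtr1 ler_psqrt// nnegrE// sqnorm_ge0. Qed.

Lemma enorm_lt1 N (x : 'rV[R]_N) : (enorm x < 1) = (sqnorm x < 1).
Proof. by rewrite -{1}sqrtr1 ltr_sqrt. Qed.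

Lemma cvg_enorm N (T : topologicalType) (f : T -> 'rV[R]_N) (x : T) :
  (forall i, (fun y => f y 0 i) @ x --> f x 0 i) ->
  (fun y => enorm (f y)) @ x --> enorm (f x).
Proof.
move=> /cvg_sqnorm cf.
apply: (@cvg_comp _ _ _ (fun y => sqnorm (f y)) Num.sqrt _ _ _ cf).
exact: sqrt_continuous.
Qed.

Lemma cvg_excess (T : topologicalType) (f : T -> 'rV[R]_k) (x : T) c :
  (forall i, (fun y => f y 0 i) @ x --> f x 0 i) ->
  (fun y => excess col (f y) c) @ x --> excess col (f x) c.
Proof.
move=> cf; rewrite /excess; apply: cvgB.
  exact: (@cvg_sumr _ _ _ _ _ (fun i y => f y 0 i)).
apply: (@cvg_bigmax _ _ _ _ _ (fun i y => f y 0 i) (fun=> 0)) => //.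
exact: cvg_cst.
Qed.

(** [F] and [G] are mutually inverse between the disk and the closed cell of [S], the open disk
    matching the points of full support. Continuity is asked in the ambient row spaces, so that it
    restricts to any subspace. *)
Definition face_chart S N := exists (F : 'rV[R]_N -> 'rV[R]_k) G,
  (forall x, closed_disk x ->
    [/\ bisimplex col (F x), supp (F x) \subset S,
        sqnorm x < 1 <-> supp (F x) = S, G (F x) = x & F @ x --> F x]) /\
  (forall w, bisimplex col w -> supp w \subset S ->
    [/\ closed_disk (G w), F (G w) = w & G @ w --> G w]).

(** * Charts of faces with at least two elements of each colour *)

Section BigFace.
Variables (S : {set 'I_k}) (N : nat) (base : bool -> 'I_k) (e : 'I_N -> 'I_k).
Hypothesis baseS : forall c, base c \in colour_class col S c.
Hypothesis class_gt1 : forall c, (1 < #|colour_class col S c|)%N.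
Hypothesis e_inj : injective e.
Hypothesis eS : forall t, e t \in S.
Hypothesis e_base : forall t c, e t != base c.
Hypothesis e_onto : forall i, i \in S -> i = base (col i) \/ exists t, e t = i.

Let pr c : R := #|colour_class col S c|%:R - 1.

Let pr_gt0 c : 0 < pr c.
Proof. by rewrite subr_gt0 (ltr_nat _ 1). Qed.

Let baseSS c : base c \in S.
Proof. by have := baseS c; rewrite inE => /andP[]. Qed.

Let col_base c : col (base c) = c.
Proof. by have := baseS c; rewrite inE => /andP[_ /eqP]. Qed.

(* The cone over the face has linear coordinates [coords] transverse to
   the translations, and [height] measures the distance to the boundary along
   them. *)
Definition coords w : 'rV[R]_N :=
  \row_t (w 0 (e t) - w 0 (base (col (e t)))).

Definition height w : R :=
  \big[Num.min/pr false * w 0 (base false)]_(i in S) (pr (col i) * w 0 i).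

Lemma height_le w i : i \in S -> height w <= pr (col i) * w 0 i.
Proof. exact: bigmin_le_cond. Qed.

(** The minimum is attained because its starting value is the term of [base false], an element of
    [S]. *)
Lemma ex_height w : exists2 i, i \in S & height w = pr (col i) * w 0 i.
Proof.
apply: (big_ind (fun v => exists2 i, i \in S & v = pr (col i) * w 0 i)).
- by exists (base false); rewrite ?col_base.
- move=> x y xi yi; rewrite minEle; by case: ifP.
- by move=> i iS; exists i.
Qed.

Lemma heightZ w (l : R) : 0 <= l -> height (l *: w) = l * height w.
Proof.
move=> l0; have [i iS hw] := ex_height w.
apply/eqP; rewrite eq_le; apply/andP; split.
  by rewrite hw mulrCA (le_trans (height_le _ iS))// mxE.
have [j jS ->] := ex_height (l *: w).
by rewrite mxE mulrCA ler_wpM2l// height_le.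
Qed.

Lemma coordsZ w (l : R) : coords (l *: w) = l *: coords w.
Proof. by apply/rowP => t; rewrite !mxE mulrBr. Qed.

Lemma height_ge0 w : cone col w -> 0 <= height w.
Proof.
by move=> [w0 _]; have [i _ ->] := ex_height w; rewrite mulr_ge0// ltW.
Qed.

(** Equal coordinates make [u] and [v] differ by a constant [t c] on each colour class; the two
    excess equations then make [pr c * t c] independent of [c], and equal heights force this common
    value to be 0. *)
Lemma cone_inj (u v : 'rV[R]_k) : cone col u -> cone col v ->
  supp u \subset S -> supp v \subset S ->
  coords u = coords v -> height u = height v -> u = v.
Proof.
move=> [u0 eu] [v0 ev] uS vS uv huv.
pose t c := u 0 (base c) - v 0 (base c).
have uvt i : i \in S -> u 0 i = v 0 i + t (col i).
  move=> iS; have [->|[s <-]] := e_onto iS.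
    by rewrite col_base /t addrC subrK.
  have := congr1 (fun M : 'rV_N => M 0 s) uv; rewrite /= !mxE /t => h.
  by apply/eqP; rewrite -subr_eq0; apply/eqP; move: h; lra.
have shift c : excess col u c = excess col v c + pr c * t c.
  apply: (excess_shift (S := S)) => //; first exact: ltnW.
  by move=> i; rewrite inE => /andP[iS /eqP <-]; exact: uvt.
have pt c : pr c * t c = pr false * t false.
  by case: c => //; have := shift false; have := shift true; lra.
(* Testing each height at the minimizer of the other point bounds the common value by 0 from both
   sides. *)
have pt0 : pr false * t false = 0.
  have [i iS hu] := ex_height u; have [j jS hv] := ex_height v.
  have := height_le u jS; have := height_le v iS.
  have := pt (col i); have := pt (col j).
  by move: huv; rewrite hu hv uvt// (uvt j)//; lra.
apply/rowP => i; have [iS|iS] := boolP (i \in S); last first.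
  by rewrite (proj2 (supp_sub u S) uS)// (proj2 (supp_sub v S) vS).
have := pt (col i); rewrite uvt// pt0 => /eqP; rewrite mulf_eq0 gt_eqF//=.
by move=> /eqP ->; rewrite addr0.
Qed.

(* [lifted x] is the point of the cone with coordinates [x] and height
   [1 - enorm x]: [lift_coords x] has coordinates [x], [pushed x] has in addition
   minimum 0 on each colour class, and a further translation of each class gives
   both the excess [level x]. *)
Definition lift_coords (x : 'rV[R]_N) i : R := \sum_(t | e t == i) x 0 t.

Definition low x c : R :=
  \big[Num.max/0]_(i in colour_class col S c) - lift_coords x i.

Definition pushed (x : 'rV[R]_N) : 'rV[R]_k :=
  \row_i (if i \in S then lift_coords x i + low x (col i) else 0).

Definition level (x : 'rV[R]_N) : R :=
  Num.max (excess col (pushed x) false) (excess col (pushed x) true)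
  + 1 - enorm x.

Definition lifted (x : 'rV[R]_N) : 'rV[R]_k :=
  \row_i (if i \in S then
    pushed x 0 i + (level x - excess col (pushed x) (col i)) / pr (col i)
  else 0).

Lemma lift_coords_base x c : lift_coords x (base c) = 0.
Proof. by apply: big_pred0 => t; apply/negbTE. Qed.

Lemma lift_coords_e x t : lift_coords x (e t) = x 0 t.
Proof. by apply: big_pred1 => s /=; rewrite (inj_eq e_inj). Qed.

Lemma pushed_ge0 x i : 0 <= pushed x 0 i.
Proof.
rewrite mxE; case: ifPn => // iS; rewrite -lerBlDl sub0r /low.
apply: (@le_bigmax_cond _ _ _ _ i
  (fun j => j \in colour_class col S (col i)) (fun j => - lift_coords x j)).
by rewrite inE iS eqxx.
Qed.

(** The default 0 in [low] is the value attained at [base c], where [lift_coords] vanishes, so the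
    maximum is reached inside the class. *)
Lemma ex_pushed0 x c : exists2 i, i \in colour_class col S c & pushed x 0 i = 0.
Proof.
have [i iS lowi] :
    exists2 i, i \in colour_class col S c & low x c = - lift_coords x i.
  apply: (big_ind (fun v =>
    exists2 i, i \in colour_class col S c & v = - lift_coords x i)).
  - by exists (base c); rewrite ?lift_coords_base ?oppr0.
  - by move=> a b ai bi; rewrite maxEle; case: ifP.
  - by move=> i iS; exists i.
exists i => //; move: iS; rewrite inE mxE => /andP[-> /eqP ->].
by rewrite lowi subrr.
Qed.

Lemma supp_pushed x : supp (pushed x) \subset S.
Proof. by apply/supp_sub => i iS; rewrite mxE (negbTE iS). Qed.

Lemma supp_lifted x : supp (lifted x) \subset S.
Proof. by apply/supp_sub => i iS; rewrite mxE (negbTE iS). Qed.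

Lemma excess_le_level x c :
  1 - enorm x <= level x - excess col (pushed x) c.
Proof.
rewrite /level.
have : excess col (pushed x) c <=
  Num.max (excess col (pushed x) false) (excess col (pushed x) true).
  by rewrite le_max; case: c; rewrite lexx ?orbT.
lra.
Qed.

Lemma lifted_ge0 x i : closed_disk x -> 0 <= lifted x 0 i.
Proof.
move=> dx; rewrite mxE; case: ifPn => // iS.
rewrite addr_ge0 ?pushed_ge0// divr_ge0 ?(ltW (pr_gt0 _))//.
by rewrite (le_trans _ (excess_le_level _ _))// subr_ge0 enorm_le1.
Qed.

Lemma excess_lifted x c : closed_disk x -> excess col (lifted x) c = level x.
Proof.
move=> dx.
rewrite (excess_shift (S := S) (v := pushed x)
  (t := (level x - excess col (pushed x) c) / pr c)) -?/(pr c).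
- by rewrite mulrC divfK ?gt_eqF// addrC subrK.
- by move=> i; exact: lifted_ge0.
- by move=> i; exact: pushed_ge0.
- exact: supp_lifted.
- exact: supp_pushed.
- exact: ltnW.
- by move=> i; rewrite inE => /andP[iS /eqP <-]; rewrite mxE iS.
Qed.

Lemma cone_lifted x : closed_disk x -> cone col (lifted x).
Proof.
move=> dx; split=> [i|]; first exact: lifted_ge0.
by rewrite !excess_lifted.
Qed.

Lemma coords_lifted x : coords (lifted x) = x.
Proof.
apply/rowP => t; rewrite mxE [lifted x 0 (e t)]mxE [lifted x 0 (base _)]mxE.
rewrite eS baseSS [pushed x 0 (e t)]mxE [pushed x 0 (base _)]mxE.
rewrite eS baseSS !col_base lift_coords_base lift_coords_e; ring.
Qed.

(** Every weighted coordinate is a nonnegative term plus [level x] minus an excess, hence at least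
    [1 - enorm x]. Equality holds on the colour of larger excess, at an element where [pushed x]
    vanishes. *)
Lemma height_lifted x : closed_disk x -> height (lifted x) = 1 - enorm x.
Proof.
move=> dx; have h i : i \in S -> pr (col i) * lifted x 0 i =
    pr (col i) * pushed x 0 i + (level x - excess col (pushed x) (col i)).
  by move=> iS; rewrite mxE iS mulrDr [X in _ + X]mulrC divfK// gt_eqF.
apply/eqP; rewrite eq_le; apply/andP; split; last first.
  have [i iS ->] := ex_height (lifted x); rewrite h//.
  rewrite (le_trans (excess_le_level x (col i)))// lerDr.
  by rewrite mulr_ge0 ?pushed_ge0// ltW.
have [c hc] : exists c, level x - excess col (pushed x) c = 1 - enorm x.
  rewrite /level maxEle; case: ifP => _; [exists true|exists false]; ring.
have [i] := ex_pushed0 x c; rewrite inE => /andP[iS /eqP ic] i0.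
by rewrite -hc (le_trans (height_le _ iS))// h// i0 mulr0 add0r ic.
Qed.

Let total w := \sum_i w 0 i.

(** A zero total would make [lifted x] the zero vector, with zero coordinates and height, whence
    both [x = 0] and [1 - enorm x = 0]. *)
Lemma total_lifted x : closed_disk x -> 0 < total (lifted x).
Proof.
move=> dx; rewrite lt_def sumr_ge0 ?andbT; last first.
  by move=> i _; exact: lifted_ge0.
apply/negP; rewrite psumr_eq0 => [/allP u0|i _]; last exact: lifted_ge0.
have {}u0 : lifted x = 0.
  apply/rowP => i; rewrite [RHS]mxE; apply/eqP; apply: u0.
  by rewrite mem_index_enum.
have := coords_lifted x; have := height_lifted dx.
rewrite u0 -(scale0r 0) heightZ// coordsZ !scale0r mul0r => /[swap] <-.
by rewrite enorm0 subr0 => /eqP; rewrite eq_sym oner_eq0.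
Qed.

(** The lifted points form the section of the cone where height plus norm of the coordinates is 1.
    [face_map] projects it radially to the section of total 1, and [face_coords] rescales back. *)
Definition face_map x := (total (lifted x))^-1 *: lifted x.

Definition face_coords w := (height w + enorm (coords w))^-1 *: coords w.

(** By [cone_inj], a point with zero height and zero coordinates is the origin, whose total is not
    1. *)
Lemma radius_gt0 w : bisimplex col w -> supp w \subset S ->
  0 < height w + enorm (coords w).
Proof.
move=> [cw w1] wS; rewrite lt_def addr_ge0 ?height_ge0 ?sqrtr_ge0// andbT.
rewrite paddr_eq0 ?height_ge0 ?sqrtr_ge0//.
apply/negP => /andP[/eqP h0 /eqP/enorm_eq0 x0].
move: w1; rewrite (_ : w = 0).
  under eq_bigr do rewrite mxE.
  by rewrite big1// => /eqP; rewrite eq_sym oner_eq0.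
have c0 : cone col (0 : 'rV[R]_k).
  by rewrite -(scale0r w); apply: cone_scale.
apply: cone_inj => //; first by apply/supp_sub => i _; rewrite mxE.
  by rewrite -(scale0r w) coordsZ scale0r.
by rewrite -(scale0r w) heightZ// mul0r.
Qed.

Lemma face_mapP x : closed_disk x ->
  [/\ bisimplex col (face_map x), supp (face_map x) \subset S,
      sqnorm x < 1 <-> supp (face_map x) = S & face_coords (face_map x) = x].
Proof.
move=> dx; have T0 := total_lifted dx.
have T'0 : 0 < (total (lifted x))^-1 by rewrite invr_gt0.
have cw : cone col (face_map x).
  by apply: cone_scale; [exact: ltW|exact: cone_lifted].
have suppE : supp (face_map x) = supp (lifted x).
  by apply/setP => i; rewrite !inE mxE mulf_eq0 gt_eqF.
split; rewrite ?suppE//; last 2 first.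
(* The support is all of [S] exactly when the height, a minimum of positive multiples of the
   coordinates on [S], is positive. *)
- rewrite -enorm_lt1 -subr_gt0 -(height_lifted dx); split=> [h0|Su].
    apply/eqP; rewrite finset.eqEsubset supp_lifted.
    apply/fintype.subsetP => i iS.
    have := lt_le_trans h0 (height_le _ iS).
    by rewrite inE pmulr_rgt0//; exact: lt0r_neq0.
  have [i] := ex_height (lifted x); rewrite -{1}Su inE => ui ->.
  by rewrite mulr_gt0// lt_def ui lifted_ge0.
- rewrite /face_coords heightZ ?coordsZ ?enormZ// ?(ltW T'0)//.
  rewrite coords_lifted height_lifted// -mulrDr subrK mulr1 invrK.
  by rewrite scalerA divff ?gt_eqF// scale1r.
- split=> //; under eq_bigr do rewrite mxE.
  by rewrite -mulr_sumr mulVf// gt_eqF.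
- exact: supp_lifted.
Qed.

Lemma face_coordsP w : bisimplex col w -> supp w \subset S ->
  closed_disk (face_coords w) /\ face_map (face_coords w) = w.
Proof.
move=> bw wS; have r0 := radius_gt0 bw wS; have [cw w1] := bw.
set r := height w + enorm (coords w) in r0.
have r'0 : 0 <= r^-1 by rewrite invr_ge0 ltW.
have dw : closed_disk (face_coords w).
  rewrite /closed_disk/= -enorm_le1 enormZ// mulrC ler_pdivrMr// mul1r.
  by rewrite lerDr height_ge0.
split=> //.
have -> : face_map (face_coords w) =
    (total (r^-1 *: w))^-1 *: (r^-1 *: w).
  (* Both sides lie in the cone with the same coordinates; dividing by [r] also gives the right-hand
     side height 1 minus the norm of these coordinates. *)
  rewrite /face_map; have -> // : lifted (face_coords w) = r^-1 *: w.
  apply: cone_inj.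
  - exact: cone_lifted.
  - exact: cone_scale.
  - exact: supp_lifted.
  - by apply/supp_sub => i iS; rewrite mxE (proj2 (supp_sub w S) wS)// mulr0.
  - by rewrite coords_lifted coordsZ.
  - rewrite height_lifted// enormZ// heightZ//.
    rewrite -[X in X - _](mulVf (lt0r_neq0 r0)) -mulrBr.
    by rewrite /r addrK.
rewrite /total; under eq_bigr do rewrite mxE.
by rewrite -mulr_sumr w1 mulr1 invrK scalerA divff ?scale1r// gt_eqF.
Qed.

Lemma cvg_face_map (T : topologicalType) (f : T -> 'rV[R]_N) (x : T) :
  closed_disk (f x) -> (forall i, (fun y => f y 0 i) @ x --> f x 0 i) ->
  (fun y => face_map (f y)) @ x --> face_map (f x).
Proof.
move=> dx cf.
have clift i : (fun y => lift_coords (f y) i) @ x --> lift_coords (f x) i.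
  exact: (@cvg_sumr _ _ _ _ _ (fun t y => f y 0 t)).
have clow c : (fun y => low (f y) c) @ x --> low (f x) c.
  apply: (@cvg_bigmax _ _ _ _ _ (fun i y => - lift_coords (f y) i) (fun=> 0)).
    exact: cvg_cst.
  by move=> i; apply: cvgN; exact: clift.
have cpush i : (fun y => pushed (f y) 0 i) @ x --> pushed (f x) 0 i.
  under eq_fun do rewrite mxE; rewrite mxE.
  by case: ifP => _; [apply: cvgD; [exact: clift|exact: clow]|exact: cvg_cst].
have cexcess c := cvg_excess (f := fun y => pushed (f y)) (c := c) cpush.
have clevel : (fun y => level (f y)) @ x --> level (f x).
  apply: cvgB; last exact: cvg_enorm.
  apply: cvgD; last exact: cvg_cst.
  apply: (@continuous_max _ _ (fun y => excess col (pushed (f y)) false)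
    (fun y => excess col (pushed (f y)) true) x); exact: cexcess.
have clifted i : (fun y => lifted (f y) 0 i) @ x --> lifted (f x) 0 i.
  under eq_fun do rewrite mxE; rewrite mxE.
  case: ifP => _; last exact: cvg_cst.
  apply: cvgD; first exact: cpush.
  by apply: cvgM; [apply: cvgB => //; exact: cexcess|exact: cvg_cst].
apply: (@cvg_row _ _ _ (fun y => face_map (f y))) => i.
rewrite /face_map; under eq_fun do rewrite mxE; rewrite mxE.
apply: cvgM; last exact: clifted.
apply: cvgV; first by rewrite gt_eqF// total_lifted.
exact: (@cvg_sumr _ _ _ _ _ (fun i y => lifted (f y) 0 i)).
Qed.

Lemma cvg_face_coords (T : topologicalType) (f : T -> 'rV[R]_k) (x : T) :
  bisimplex col (f x) -> supp (f x) \subset S ->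
  (forall i, (fun y => f y 0 i) @ x --> f x 0 i) ->
  (fun y => face_coords (f y)) @ x --> face_coords (f x).
Proof.
move=> bw wS cf.
have ccoords t : (fun y => coords (f y) 0 t) @ x --> coords (f x) 0 t.
  by under eq_fun do rewrite mxE; rewrite mxE; apply: cvgB; exact: cf.
apply: (@cvg_row _ _ _ (fun y => face_coords (f y))) => t.
rewrite /face_coords; under eq_fun do rewrite mxE; rewrite mxE.
apply: cvgM; last exact: ccoords.
apply: cvgV; first by rewrite gt_eqF// radius_gt0.
apply: cvgD; last exact: (cvg_enorm (f := fun y => coords (f y))).
apply: (@cvg_bigmin _ _ _ _ _ (fun i y => pr (col i) * f y 0 i)
  (fun y => pr false * f y 0 (base false))) => [|i];
  by apply: cvgM; [exact: cvg_cst|exact: cf].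
Qed.

Lemma face_chart_of_enum : face_chart S N.
Proof.
exists face_map, face_coords; split=> [x dx|w bw wS].
  have [? ? ? ?] := face_mapP dx; split=> //;
  by apply: (@cvg_face_map _ id x) => // i; exact: coord_continuous.
have [? ?] := face_coordsP bw wS; split=> //;
  by apply: (@cvg_face_coords _ id w) => // i; exact: coord_continuous.
Qed.

End BigFace.
End Charts.

(** * Charts of all faces *)

Section FaceCharts.
Variables (R : realType) (k : nat) (col : 'I_k -> bool).
Implicit Types (w : 'rV[R]_k) (S : {set 'I_k}) (c : bool).

Lemma face_chart_big S N : (forall c, (1 < #|colour_class col S c|)%N) ->
  #|S| = N.+2 -> face_chart R col S N.
Proof.
move=> Sgt1 SN.
have /choice[base baseS] c : exists i, i \in colour_class col S c.
  by apply/card_gt0P; exact: ltnW.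
have col_base c : col (base c) = c.
  by have := baseS c; rewrite inE => /andP[_ /eqP].
have baseSS c : base c \in S by have := baseS c; rewrite inE => /andP[].
(* One reference element of each colour is removed; the remaining [N] elements index the coordinates
   of the disk. *)
pose D := S :\ base false :\ base true.
have base_neq : base true != base false.
  by apply/eqP => /(congr1 col); rewrite !col_base.
have DN : #|D| = N.
  have := cardsD1 (base false) S; rewrite baseSS SN.
  have := cardsD1 (base true) (S :\ base false).
  by rewrite -/D !inE baseSS base_neq => -> [->].
pose e (t : 'I_N) := enum_val (cast_ord (esym DN) t).
have eD t : e t \in D := enum_valP _.
apply: (@face_chart_of_enum _ _ _ S N base e) => //.
- by move=> t s /enum_val_inj/cast_ord_inj.
- by move=> t; have := eD t; rewrite !inE => /and3P[].
- by move=> t c; have := eD t; rewrite !inE; case: c => /and3P[].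
- move=> i iS; have [->|ib] := eqVneq i (base (col i)).
    by left; rewrite col_base.
  have iD : i \in D.
    by rewrite !inE iS andbT; move: ib; apply: contraR; rewrite negb_and !negbK
      => /orP[] /eqP ->; rewrite col_base.
  right; exists (cast_ord DN (enum_rank_in iD i)).
  by rewrite /e cast_ordK enum_rankK_in.
Qed.

(** With at most one element of each colour both excesses are 0, so the equation of the complex
    holds automatically. *)
Lemma bisimplex_small w S : (forall i, 0 <= w 0 i) -> supp w \subset S ->
  (forall c, (#|colour_class col S c| <= 1)%N) -> \sum_i w 0 i = 1 ->
  bisimplex col w.
Proof.
move=> w0 wS S1 w1; split => //; split=> //.
have e0 c : excess col w c = 0.
  apply/eqP; rewrite excess_eq0// (leq_trans _ (S1 c))// subset_leq_card//.
  by apply/fintype.subsetP => i; rewrite !inE => /andP[wi ->];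
    rewrite (fintype.subsetP wS)// inE.
by rewrite !e0.
Qed.

Lemma sum_row_eq w (r : seq 'I_k) : uniq r ->
  (forall i, i \notin r -> w 0 i = 0) ->
  \sum_i w 0 i = \sum_(i <- r) w 0 i.
Proof.
move=> ur wr; rewrite (bigID (mem r))/= [X in _ + X]big1 ?addr0//.
by rewrite -big_filter; apply: perm_big; apply: uniq_perm;
  rewrite ?filter_uniq ?index_enum_uniq// => i;
  rewrite mem_filter mem_index_enum andbT.
Qed.

Lemma face_chart_vertex i : face_chart R col [set i] 0.
Proof.
exists (fun=> delta_mx 0 i), (fun=> 0); split=> [x _|w bw /supp_sub wi].
  have suppE : supp (delta_mx 0 i : 'rV[R]_k) = [set i]%SET.
    by apply/setP => j; rewrite !inE mxE eqxx/= pnatr_eq0; case: (j == i).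
  split.
  - apply: (@bisimplex_small _ [set i]%SET); rewrite ?suppE//.
    + by move=> j; rewrite mxE ler0n.
    + move=> c; rewrite -(cards1 i) subset_leq_card//.
      by apply/fintype.subsetP => j; rewrite !inE => /andP[].
    + rewrite (@sum_row_eq _ [:: i])//; first by rewrite big_seq1 mxE !eqxx.
      by move=> j; rewrite inE mxE => /negbTE ->.
  - by rewrite suppE.
  - by rewrite suppE /sqnorm big_ord0.
  - by apply/rowP => -[].
  - exact: (cvg_cst _ (FF := nbhs_filter x)).
split.
- by rewrite /closed_disk/= /sqnorm big_ord0.
- apply/rowP => j; rewrite mxE eqxx/=; have [->|ji] := eqVneq j i.
    have [_ <-] := bw; rewrite (@sum_row_eq _ [:: i]) ?big_seq1//.
    by move=> l; rewrite inE => li; rewrite wi// inE.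
  by rewrite wi// inE.
- exact: (cvg_cst _ (FF := nbhs_filter w)).
Qed.

Lemma sqnorm1 (x : 'rV[R]_1) : sqnorm x = x 0 0 ^+ 2.
Proof. by rewrite /sqnorm big_ord1. Qed.

Lemma face_chart_edge i j : col i = false -> col j = true ->
  face_chart R col [set i; j] 1.
Proof.
move=> ic jc.
have ij : i != j by apply/eqP => ij; rewrite ij jc in ic.
(* The interval from -1 to 1 parametrizes the segment affinely, 1 going to vertex [i] and -1 to
   vertex [j]; the difference of the two barycentric coordinates recovers the parameter. *)
pose F (x : 'rV[R]_1) : 'rV[R]_k := \row_l
  (if l == i then (1 + x 0 0) / 2 else if l == j then (1 - x 0 0) / 2 else 0).
pose G w : 'rV[R]_1 := \row_t (w 0 i - w 0 j).
have sumw w : supp w \subset [set i; j]%SET -> \sum_l w 0 l = w 0 i + w 0 j.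
  move=> /supp_sub ws; rewrite (@sum_row_eq _ [:: i; j]).
  - by rewrite big_cons big_seq1.
  - by rewrite /= inE ij.
  - by move=> l; rewrite !inE => lij; rewrite ws// !inE.
have Fi x : F x 0 i = (1 + x 0 0) / 2 by rewrite mxE eqxx.
have Fj x : F x 0 j = (1 - x 0 0) / 2 by rewrite mxE eq_sym (negbTE ij) eqxx.
have FS x : supp (F x) \subset [set i; j]%SET.
  by apply/supp_sub => l; rewrite !inE mxE => /norP[/negbTE -> /negbTE ->].
have cF (T : topologicalType) (f : T -> R) (y : T) l : f @ y --> f y ->
    (fun z => if l == i then (1 + f z) / 2 else if l == j then (1 - f z) / 2
      else 0) @ y -->
    (if l == i then (1 + f y) / 2 else if l == j then (1 - f y) / 2 else 0).
  move=> cf; case: ifP => _; last case: ifP => _; last exact: cvg_cst.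
    by apply: cvgM; [apply: cvgD => //|]; exact: cvg_cst.
  by apply: cvgM; [apply: cvgB => //|]; exact: cvg_cst.
exists F, G; split=> [x dx|w bw wS].
  have [x1 x2] : -1 <= x 0 0 /\ x 0 0 <= 1.
    by move: dx; rewrite /closed_disk/= sqnorm1; split; nra.
  split=> //.
  - apply: (bisimplex_small (S := [set i; j]%SET)) => //.
    + by move=> l; rewrite mxE; case: ifP => _; [lra|case: ifP => _; [lra|]].
    + move=> c; rewrite -(cards1 (if c then j else i)) subset_leq_card//.
      apply/fintype.subsetP => l; rewrite !inE => /andP[/orP[]/eqP-> /eqP <-];
        by rewrite ?ic ?jc.
    + by rewrite sumw// Fi Fj; lra.
  - rewrite sqnorm1; split=> [x1'|SE].
      apply/eqP; rewrite finset.eqEsubset FS; apply/fintype.subsetP => l.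
      rewrite !inE => /orP[]/eqP ->; rewrite ?Fi ?Fj gt_eqF//; nra.
    have : i \in supp (F x) by rewrite SE !inE eqxx.
    have : j \in supp (F x) by rewrite SE !inE eqxx orbT.
    rewrite !inE Fi Fj => /eqP hj /eqP hi.
    have {}hi : -1 < x 0 0.
      by rewrite lt_neqAle x1 andbT; apply/eqP => h; apply: hi; rewrite -h; lra.
    have {}hj : x 0 0 < 1.
      by rewrite lt_neqAle x2 andbT; apply/eqP => h; apply: hj; rewrite h; lra.
    by nra.
  - by apply/rowP => t; rewrite ord1 mxE Fi Fj; lra.
  - apply: cvg_row => l; rewrite /F; under eq_fun do rewrite mxE; rewrite mxE.
    have cx : (fun y : 'rV[R]_1 => y 0 0) @ x --> x 0 0.
      by exact: coord_continuous.
    exact: (@cF _ _ x l cx).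
have [[w0 _]] := bw; rewrite sumw// => w1.
have wi := w0 i; have wj := w0 j.
split.
- by rewrite /closed_disk/= sqnorm1 mxE; nra.
- apply/rowP => l; rewrite mxE mxE.
  case: eqP => [->|/eqP li]; first lra.
  case: eqP => [->|/eqP lj]; first lra.
  by rewrite (proj2 (supp_sub w _) wS)// !inE (negbTE li).
- apply: cvg_row => t; rewrite /G; under eq_fun do rewrite mxE; rewrite mxE.
  have cc l : (fun u : 'rV[R]_k => u 0 l) @ w --> w 0 l.
    by exact: coord_continuous.
  exact: (cvgB (cc i) (cc j)).
Qed.

Lemma face_chart_face S : is_face col S -> face_chart R col S (face_dim S).
Proof.
rewrite /is_face => /or3P[S1|/andP[S1 S2]|/andP[S1 S2]].
- have /cards1P[i ->] : #|S| == 1 by rewrite (card_colour_class col).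
  by rewrite /face_dim cards1; exact: face_chart_vertex.
- have S12 : #|S| = 2 by rewrite (card_colour_class col) (eqP S1) (eqP S2).
  have fS : is_face col S by rewrite /is_face S1 S2 orbT.
  have [i [j [SE ic jc]]] := face_card2 fS S12.
  by rewrite /face_dim S12/= SE; exact: face_chart_edge.
- have Sgt : (2 < #|S|)%N by rewrite (card_colour_class col); lia.
  rewrite /face_dim leqNgt Sgt/=; apply: face_chart_big; first by case.
  by move: Sgt; case: #|S| => [|[|]].
Qed.

End FaceCharts.

(** * The complex and its 1-skeleton *)

Section BisimplexComplex.
Variables (R : realType) (k : nat) (col : 'I_k -> bool) (i0 : 'I_k).

Let X : set 'rV[R]_k := bisimplex col.

Definition face := {S : {set 'I_k} | is_face col S}.

Implicit Types c : face.

Definition chart c : 'rV[R]_(face_dim (\val c)) -> 'rV[R]_k :=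
  projT1 (cid (face_chart_face R (valP c))).

Definition chart_inv c : 'rV[R]_k -> 'rV[R]_(face_dim (\val c)) :=
  projT1 (cid (projT2 (cid (face_chart_face R (valP c))))).

Arguments chart : clear implicits.
Arguments chart_inv : clear implicits.

Lemma chartP c (x : 'rV[R]_(face_dim (\val c))) : closed_disk x ->
  [/\ X (chart c x), supp (chart c x) \subset \val c,
      sqnorm x < 1 <-> supp (chart c x) = \val c, chart_inv c (chart c x) = x &
      chart c @ x --> chart c x].
Proof.
exact: (proj1 (projT2 (cid (projT2 (cid (face_chart_face R (valP c))))))).
Qed.

Lemma chart_invP c w : X w -> supp w \subset \val c ->
  [/\ closed_disk (chart_inv c w), chart c (chart_inv c w) = w &
      chart_inv c @ w --> chart_inv c w].
Proof.
exact: (proj2 (projT2 (cid (projT2 (cid (face_chart_face R (valP c))))))).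
Qed.

Lemma bisimplex_neq0 : exists w, w \in X.
Proof.
have [F [G [FP _]]] := @face_chart_vertex R k col i0.
by exists (F 0); apply/mem_set; have [|] := FP 0;
  rewrite /closed_disk/= /sqnorm ?big_ord0.
Qed.

Definition base_point : set_type X :=
  let: exist w wX := cid bisimplex_neq0 in SigSub wX.

(** The chart lands in [X] only on the closed disk; [base_point] is a filler value elsewhere. *)
Definition face_char c (x : 'rV[R]_(face_dim (\val c))) : set_type X :=
  insubd base_point (chart c x).

Arguments face_char : clear implicits.

Lemma val_face_char c (x : 'rV[R]_(face_dim (\val c))) :
  closed_disk x -> \val (face_char c x) = chart c x.
Proof. by move=> /chartP[Xx _ _ _ _]; apply: insubdK; exact: mem_set. Qed.

Lemma valX (p : set_type X) : X (\val p).
Proof. exact/set_mem/valP. Qed.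

Definition support_face (p : set_type X) : face :=
  exist _ (supp (\val p)) (supp_face (valX p)).

(** Together with [face_char_open], this turns membership in cells into a condition on supports, so
    that covering, disjointness and the cell order become statements about finite sets. *)
Lemma face_char_closed c p :
  (face_char c @` @closed_disk R (face_dim (\val c))) p <->
  supp (\val p) \subset \val c.
Proof.
split=> [[x dx <-]|pc].
  by rewrite val_face_char//; have [] := chartP dx.
have [dx cx _] := chart_invP (valX p) pc.
by exists (chart_inv c (\val p)) => //; apply: val_inj; rewrite val_face_char.
Qed.

Lemma open_disk_closed N : @open_disk R N `<=` @closed_disk R N.
Proof. by move=> x; exact: ltW. Qed.

Lemma face_char_open c p :
  (face_char c @` @open_disk R (face_dim (\val c))) p <->
  supp (\val p) = \val c.
Proof.
split=> [[x ox <-]|pc].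
  have dx := open_disk_closed ox.
  by rewrite val_face_char//; have [_ _ [+ _] _ _] := chartP dx; apply.
have [|x dx xp] := proj2 (face_char_closed c p); first by rewrite pc.
exists x => //; have [_ _ [_ h] _ _] := chartP dx.
by apply: h; rewrite -val_face_char// xp.
Qed.

(** [X] carries the initial topology of its inclusion, so continuity into it is continuity of the
    ambient chart, and the inverse is [chart_inv] after the inclusion. *)
Lemma face_char_embedding c :
  embedding_on (@closed_disk R (face_dim (\val c))) (face_char c).
Proof.
split.
  apply: continuous_comp_initial.
  have cc : {within @closed_disk R (face_dim (\val c)), continuous (chart c)}.
    by apply: continuous_in_subspaceT => x /set_mem dx; have [] := chartP dx.
  apply: subspace_eq_continuous cc => x /set_mem dx.
  by rewrite /= /from_subspace -val_face_char.
exists (chart_inv c \o \val); split=> [x dx|].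
  by rewrite /= val_face_char//; have [] := chartP dx.
apply: continuous_in_subspaceT => p /set_mem /face_char_closed pc.
apply: continuous_comp; first exact: initial_continuous.
by have [] := chart_invP (valX p) pc.
Qed.

Lemma bisimplex_hausdorff : hausdorff_space (set_type X).
Proof.
move=> p q pq; apply: val_inj; apply: (@norm_hausdorff _ 'rV[R]_k) => A B pA qB.
have [z [Az Bz]] := pq _ _ (@initial_continuous _ _ set_val p A pA)
  (@initial_continuous _ _ set_val q B qB).
by exists (\val z).
Qed.

Lemma face_char_disjoint c c' :
  (face_char c @` @open_disk R (face_dim (\val c))) `&`
  (face_char c' @` @open_disk R (face_dim (\val c'))) !=set0 -> c = c'.
Proof.
by move=> [p [/face_char_open pc /face_char_open pc']]; apply: val_inj;
  rewrite -pc -pc'.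
Qed.

Lemma face_char_cover (p : set_type X) :
  exists c, (face_char c @` @open_disk R (face_dim (\val c))) p.
Proof. by exists (support_face p); apply/face_char_open. Qed.

Lemma face_char_boundary c : exists F : set face,
  [/\ finite_set F,
      forall c', F c' -> (face_dim (\val c') < face_dim (\val c))%N &
      face_char c @` @disk_boundary R (face_dim (\val c)) `<=`
      \bigcup_(c' in F) (face_char c' @` @open_disk R (face_dim (\val c')))].
Proof.
(* A boundary point has its support inside that of the cell but not equal to it, so it lies in the
   open cell of a proper subface. *)
exists [set c' : face | \val c' \proper \val c]; split=> [|c' cc'|p [x bx xp]].
- exact: finite_finset.
- by apply: face_dim_lt cc'; exact: valP.
have dx : closed_disk x by rewrite /closed_disk/= bx.
have [_ Sx xS _ _] := chartP dx.
exists (support_face p); last exact/face_char_open.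
rewrite /= finset.properEneq -xp val_face_char// Sx andbT.
by apply/eqP => /(proj2 xS); rewrite bx ltxx.
Qed.

(** There are finitely many faces, so [A] is a finite union of its closed traces on the cells. *)
Lemma face_char_weak (A : set (set_type X)) :
  (forall c,
    closed (A `&` (face_char c @` @closed_disk R (face_dim (\val c))))) ->
  closed A.
Proof.
move=> cA; rewrite (_ : A = \bigcup_(c in [set: face])
    (A `&` (face_char c @` @closed_disk R (face_dim (\val c))))).
  by apply: closed_bigcup => //; exact: finite_finset.
apply/seteqP; split=> [p Ap|p [c _ []]//].
exists (support_face p) => //.
by split=> //; apply/face_char_closed.
Qed.

Definition bisimplex_complex : cw_complex R := CWComplex
  bisimplex_hausdorff (fun c => proj1 (face_char_embedding c))
  (fun c => embedding_onS (@open_disk_closed _) (face_char_embedding c))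
  face_char_disjoint face_char_cover face_char_boundary face_char_weak.

Lemma bisimplex_complex_regular : regular bisimplex_complex.
Proof. exact: face_char_embedding. Qed.

Lemma bisimplex_cell_le (c c' : cell bisimplex_complex) :
  cell_le c c' <-> \val c \subset \val c'.
Proof.
split=> [cc'|cc' p /face_char_closed pc]; last first.
  by apply/face_char_closed; exact: fintype.subset_trans cc'.
(* The centre of the disk gives a point whose support is exactly [c]; its membership in the closed
   cell of [c'] is the inclusion. *)
set p := face_char c 0.
have pc : supp (\val p) = \val c.
  apply/face_char_open; exists 0 => //.
  by rewrite /open_disk/= /sqnorm big1// => i _; rewrite mxE expr0n.
by rewrite -pc; apply/face_char_closed/cc'/face_char_closed; rewrite pc.
Qed.

End BisimplexComplex.

(** * The two colour classes and the 1-skeleton *)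

Definition side m n (i : 'I_(m + n)) : bool :=
  if fintype.split i is inr _ then true else false.

Lemma side_lshift m n i : side (@lshift m n i) = false.
Proof. by rewrite /side (unsplitK (inl i)). Qed.

Lemma side_rshift m n i : side (@rshift m n i) = true.
Proof. by rewrite /side (unsplitK (inr i)). Qed.

Lemma card_side m n c :
  #|colour_class (@side m n) [set: _] c| = if c then n else m.
Proof.
have -> : colour_class (@side m n) [set: _] c =
  if c then [set @rshift m n i | i in 'I_n]%SET
       else [set @lshift m n i | i in 'I_m]%SET.
  apply/setP => i; rewrite !inE; case: (split_ordP i) => j ->.
    rewrite side_lshift; case: c; last by rewrite imset_f.
    by apply/esym/negP => /imsetP[l _ /eqP]; rewrite eq_lrshift.
  rewrite side_rshift; case: c; first by rewrite imset_f.
  by apply/esym/negP => /imsetP[l _ /eqP]; rewrite eq_rlshift.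
case: c; rewrite card_imset ?card_ord//; [exact: rshift_inj|exact: lshift_inj].
Qed.

Section Skeleton.
Variables (R : realType) (m n : nat) (i0 : 'I_(m + n)).

Let B := bisimplex_complex R (@side m n) i0.

Lemma vertex_dim i : @cdim R B (exist _ [set i]%SET (is_face1 _ i)) == 0%N.
Proof. by rewrite /= /face_dim cards1. Qed.

Lemma edge_dim (e : 'I_m * 'I_n) :
  @cdim R B (exist _ [set lshift n e.1; rshift m e.2]%SET
    (is_face2 (side_lshift n e.1) (side_rshift m e.2))) == 1%N.
Proof. by rewrite /= /face_dim cards2 eq_lrshift. Qed.

Lemma one_skeleton_bisimplex :
  graph_iso (one_skeleton B) (complete_bipartite m n).
Proof.
(* The isomorphism is built from the bipartite graph, where a vertex or an edge directly names its
   support; surjectivity is the classification of faces of dimension 0 and 1. *)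
apply: graph_iso_sym.
pose f (v : 'I_m + 'I_n) : vertex (one_skeleton B) := 
  exist (fun c : cell B => cdim c == 0%N) _ (vertex_dim (unsplit v)).
pose g (e : 'I_m * 'I_n) : edge (one_skeleton B) := 
  exist (fun c : cell B => cdim c == 1%N) _ (edge_dim e).
exists f, g; split.
- apply: inj_surj_bijective => [v v' /(congr1 (fun c => sval (sval c)))|].
    by move=> /set1_inj; exact: can_inj (@unsplitK m n) _ _.
  move=> [[S fS] dS]; have /eqP/cards1P[i Si] := face_dim_eq0 fS (eqP dS).
  exists (fintype.split i); apply: val_inj; apply: val_inj.
  by rewrite /= fintype.splitK Si.
- apply: inj_surj_bijective => [e e' /(congr1 (fun c => sval (sval c)))/setP|].
    case: e e' => [a b] [a' b'] /= h.
    have := h (lshift n a); have := h (rshift m b).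
    rewrite !inE !eqxx orbT !eq_rlshift !eq_lrshift !orbF/=.
    rewrite (inj_eq (@lshift_inj _ _)) (inj_eq (@rshift_inj _ _)).
    by move=> /esym/eqP -> /esym/eqP ->.
  move=> [[S fS] dS].
  have [i [j [SE ic jc]]] := face_card2 fS (face_dim_eq1 fS (eqP dS)).
  case: (split_ordP i) ic => a ia; rewrite ia ?side_rshift// => _.
  case: (split_ordP j) jc => b jb; rewrite jb ?side_lshift// => _.
  by exists (a, b); apply: val_inj; apply: val_inj; rewrite /= SE ia jb.
- move=> e v; split=> [ev|/bisimplex_cell_le/=].
    apply/bisimplex_cell_le; rewrite /= finset.sub1set !inE.
    by case: ev => ->; rewrite /= eqxx ?orbT.
  rewrite finset.sub1set !inE; case: v => j /=;
    rewrite ?eq_lrshift ?eq_rlshift ?orbF.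
    by rewrite (inj_eq (@lshift_inj _ _)) => /eqP ->; left.
  by rewrite (inj_eq (@rshift_inj _ _)) => /eqP ->; right.
Qed.

End Skeleton.

Theorem theoremA (R : realType) :
  exists B : nat -> nat -> cw_complex R,
    forall m n : nat, (1 <= m)%N -> (1 <= n)%N ->
      [/\ regular (B m n),
          (exists! c : cell (B m n), maximal_cell c) /\
            homeomorphic_to_ball (B m n) (m + n)%N,
          has_dimension (B m n) (m + n)%N &
          graph_iso (one_skeleton (B m n)) (complete_bipartite m.+1 n.+1)].
Proof.
exists (fun m n => bisimplex_complex R (@side m.+1 n.+1) (lshift n.+1 ord0)).
move=> m n m1 n1; set B := bisimplex_complex _ _ _.
(* Since [m] and [n] are positive, each colour has at least two elements, so the full vertex set is
   a face. *)
have topP : is_face (@side m.+1 n.+1) [set: _].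
  by rewrite /is_face !card_side ltnS m1 ltnS n1 !orbT.
pose top : cell B := exist _ [set: _]%SET topP.
have le_top (c : cell B) : cell_le c top.
  by apply/bisimplex_cell_le; exact: finset.subsetT.
have top_le (c : cell B) : cell_le top c -> c = top.
  move=> /bisimplex_cell_le/= tc; apply: val_inj; apply/eqP.
  by rewrite /= finset.eqEsubset tc finset.subsetT.
(* There are [m + n + 2] vertices, more than 2, so the second branch of [face_dim] applies. *)
have top_dim : cdim top = (m + n)%N.
  by rewrite /= /face_dim cardsT card_ord; case: ifP; lia.
split.
- exact: bisimplex_complex_regular.
- split.
    exists top; split=> [c /top_le//|c cmax].
    by rewrite (cmax top (le_top c)).
  (* Every support lies in the full vertex set, so the closed top cell is the whole space and its
     characteristic map is the homeomorphism. *)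
  rewrite -top_dim; exists (@char_map R B top); split.
    exact: bisimplex_complex_regular.
  apply/seteqP; split=> // p _.
  by apply/face_char_closed; exact: finset.subsetT.
- split=> [|c]; first by exists top.
  rewrite -top_dim; have [->//|ct] := pselect (c = top).
  apply: ltnW; apply: (face_dim_lt (col := @side m.+1 n.+1)) => //.
    exact: valP.
  rewrite finset.properEneq finset.subsetT andbT; apply/eqP => ceq.
  by apply: ct; apply: val_inj.
- exact: one_skeleton_bisimplex.
Qed.
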